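(* Consider the primal–dual SDP pair and the one-step ADMM iteration described in the context, under the standing assumptions there ($\mathcal A$ surjective, nonempty KKT set), and suppose $Z^{(k)}\to Z_\star=X_\star-\sigma S_\star$, where $(X_\star,y_\star,S_\star)$ is a KKT point with $\operatorname{rank}X_\star+\operatorname{rank}S_\star=n$. Let $\mathcal Z_\star$ be the set of fixed points of the one-step ADMM map. Then for any $\rho_0\in(\|\mathcal M-\Pi_{\mathrm{Fix}(\mathcal M)}\|_{\mathrm{op}},1)$ there exists $\bar k\in\mathbb N$ such that $\operatorname{dist}(Z^{(k)},\mathcal Z_\star)$ converges R-linearly for $k\ge\bar k$; i.e., there exist $\alpha>0$ and $\rho\in(0,1)$ with $\operatorname{dist}(Z^{(k)},\mathcal Z_\star)\le\alpha\rho^k$ for all integers $k\ge\bar k$.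
   Context: $\mathbb S^n$ denotes the real symmetric $n\times n$ matrices with inner product $\langle X,Y\rangle=\operatorname{tr}(XY)$ and Frobenius norm $\|\cdot\|_F$; $\mathbb S^n_+$ is the positive semidefinite cone and $\Pi_{\mathbb S^n_+}$ the Frobenius-orthogonal projection onto it; $\operatorname{dist}(Z,\mathcal S)=\inf_{W\in\mathcal S}\|Z-W\|_F$. Data $C,A_1,\dots,A_m\in\mathbb S^n$, $b\in\mathbb R^m$; $\mathcal A X=(\langle A_1,X\rangle,\dots,\langle A_m,X\rangle)$, $\mathcal A^*y=\sum_i y_iA_i$. Primal: minimize $\langle C,X\rangle$ s.t. $\mathcal AX=b$, $X\in\mathbb S^n_+$; dual: maximize $b^\top y$ s.t. $\mathcal A^*y+S=C$, $S\in\mathbb S^n_+$. A KKT point is $(X,y,S)$ with $\mathcal AX=b$, $\mathcal A^*y+S=C$, $\langle X,S\rangle=0$, $X,S\in\mathbb S^n_+$. Standing assumptions: $\mathcal A$ is surjective and the KKT set is nonempty. Let $\mathcal P=\mathcal A^*(\mathcal A\mathcal A^* )^{-1}\mathcal A$ (orthogonal projection onto the range of $\mathcal A^*$) and $\mathcal P^\perp=\mathrm{Id}-\mathcal P$. For fixed $\sigma>0$ and $Z^{(0)}\in\mathbb S^n$, one-step ADMM is $Z^{(k+1)}=\mathcal P(-2\Pi_{\mathbb S^n_+}(Z^{(k)})+Z^{(k)})+\Pi_{\mathbb S^n_+}(Z^{(k)})+\mathcal A^*(\mathcal A\mathcal A^* )^{-1}b+\sigma\mathcal PC-\sigma C$.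 Since $X_\star,S_\star\succeq0$, $\langle X_\star,S_\star\rangle=0$ and strict complementarity holds, there is an orthogonal $Q_\star$ with $Z_\star=Q_\star\operatorname{diag}(\lambda_1,\dots,\lambda_n)Q_\star^\top$, $\lambda_1\ge\dots\ge\lambda_r>0>\lambda_{r+1}\ge\dots\ge\lambda_n$, $r=\operatorname{rank}X_\star$, $X_\star=Q_\star\operatorname{diag}(\lambda_1,\dots,\lambda_r,0,\dots,0)Q_\star^\top$. Define $\Theta\in\mathbb R^{(n-r)\times r}$ by $\Theta_{ij}=\lambda_j/(\lambda_j-\lambda_{i+r})$ and $\Omega=\begin{pmatrix}E_r&\Theta^\top\\ \Theta&0\end{pmatrix}\in\mathbb S^n$ ($E_r$ the all-ones $r\times r$ matrix). Let $\circ$ be the Hadamard product, $\mathcal D(H)=Q_\star(\Omega\circ(Q_\star^\top HQ_\star))Q_\star^\top$, $\mathcal D^\perp(H)=H-\mathcal D(H)$, and $\mathcal M(H)=\mathcal P\mathcal D^\perp(H)+\mathcal P^\perp\mathcal D(H)$, a linear map on $\mathbb S^n$. $\mathrm{Fix}(\mathcal M)=\{H:\mathcal M(H)=H\}$, $\Pi_{\mathrm{Fix}(\mathcal M)}$ is the orthogonal projection onto this subspace, and $\|\cdot\|_{\mathrm{op}}$ is the operator norm induced by $\|\cdot\|_F$. *)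

(* Defs.v *)
From HB Require Import structures.
From mathcomp Require Import all_boot all_order all_algebra.
From mathcomp Require Import boolp classical_sets reals.
Set Implicit Arguments.
Unset Strict Implicit.
Unset Printing Implicit Defensive.
Import Order.TTheory GRing.Theory Num.Theory.
Local Open Scope ring_scope.
Local Open Scope classical_set_scope.

Section SDP.
Variable R : realType.
Variable n : nat.
Notation mat := 'M[R]_n.

Definition symm (X : mat) : Prop := X^T = X.
Definition psd (X : mat) : Prop :=
  symm X /\ forall v : 'cV[R]_n, 0 <= (v^T *m X *m v) 0 0.
Definition inner (X Y : mat) : R := \tr (X *m Y).
Definition frob (X : mat) : R := Num.sqrt (\sum_i \sum_j (X i j) ^+ 2).

(* Frobenius-orthogonal projection onto a set S (nearest point of S);
   used for closed convex nonempty S, where it exists and is unique. *)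
Definition proj_onto (S : set mat) (Z : mat) : mat :=
  xget 0 [set P | S P /\ forall W, S W -> frob (Z - P) <= frob (Z - W)].

Definition proj_psd : mat -> mat := proj_onto psd.

Definition dist (Z : mat) (S : set mat) : R := inf [set frob (Z - W) | W in S].

Definition opnorm (L : mat -> mat) : R :=
  sup [set frob (L H) | H in [set H | symm H /\ frob H <= 1]].

Variable m : nat.
Variable A : 'I_m -> mat.

Definition opA (X : mat) : 'cV[R]_m := \col_i inner (A i) X.
Definition opAt (y : 'cV[R]_m) : mat := \sum_i y i 0 *: A i.
Definition gramA : 'M[R]_m := \matrix_(i, j) inner (A i) (A j).
Definition projP (H : mat) : mat := opAt (invmx gramA *m opA H).
Definition projPperp (H : mat) : mat := H - projP H.

Definition admm_step (C : mat) (b : 'cV[R]_m) (sigma : R) (Z : mat) : mat :=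
  projP (- 2%:R *: proj_psd Z + Z) + proj_psd Z + opAt (invmx gramA *m b)
  + sigma *: projP C - sigma *: C.

Definition kkt (C : mat) (b : 'cV[R]_m) (X : mat) (y : 'cV[R]_m) (S : mat) : Prop :=
  opA X = b /\ opAt y + S = C /\ inner X S = 0 /\ psd X /\ psd S.

Definition Omega (lam : 'I_n -> R) (r : nat) : mat :=
  \matrix_(i, j)
    if (i < r)%N && (j < r)%N then 1
    else if (r <= i)%N && (j < r)%N then lam j / (lam j - lam i)
    else if (i < r)%N && (r <= j)%N then lam i / (lam i - lam j)
    else 0.

Definition hadamard (X Y : mat) : mat := \matrix_(i, j) (X i j * Y i j).

Definition opD (Q : mat) (lam : 'I_n -> R) (r : nat) (H : mat) : mat :=
  Q *m hadamard (Omega lam r) (Q^T *m H *m Q) *m Q^T.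
Definition opDperp Q lam r (H : mat) : mat := H - opD Q lam r H.
Definition opM Q lam r (H : mat) : mat :=
  projP (opDperp Q lam r H) + projPperp (opD Q lam r H).

Definition fixM Q lam r : set mat := [set H | symm H /\ opM Q lam r H = H].

End SDP.

(* Main.v *)
Require Import Defs.
From HB Require Import structures.
From mathcomp Require Import all_boot all_order all_algebra.
From mathcomp Require Import boolp classical_sets reals.
From mathcomp Require Import ring lra.
Import Order.TTheory GRing.Theory Num.Theory.
Local Open Scope ring_scope.
Local Open Scope classical_set_scope.

(* Write Z_s for the limit and F for the ADMM map. Since Z_s is nonsingular, the
   psd projection is strictly differentiable at Z_s with derivative D, hence
     F Z - F Z' - M (Z - Z') = o(Z - Z')   as Z, Z' -> Z_s.
   A fixed direction V of M has no mixed (positive, negative) block in the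
   eigenbasis of Z_s, so Z_s + V is an exact fixed point of F when V is small.
   With H = Z - Z_s and V its projection on Fix M, apply the expansion to Z and
   Z' = Z_s + V: as H - V is orthogonal to Fix M, M contracts it by the operator
   norm of M - Pi, so the distance of H to Fix M contracts at each step. *)

(** Expanding at Z_s alone leaves an error o(|H|), which may exceed the distance of H to Fix M,
    since Z_s need not be an isolated fixed point. Expanding between Z and Z_s + V makes the error
    proportional to |H - V|, the very quantity that has to shrink; hence strict differentiability.
    Its error bound is obtained without diagonalizing Z or Z': the projection P of Z satisfies P (P
    - Z) = 0, and comparing this equation at two points leaves a linear equation with the
    eigenvalues of Z_s as coefficients and a remainder quadratic in the deviations. The gap [mu]
    between 0 and the spectrum of Z_s allows division by these coefficients. The rate is [rho0]
    itself: close to Z_s the error fits into the difference between [rho0] and the operator norm. *)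

Section Frobenius.
Context {R : realType} {n : nat}.
Implicit Types (X Y Z : 'M[R]_n) (a c : R).

(** The transpose makes this form positive definite on all square matrices; products such as P (P -
    Z) are not symmetric a priori. *)
Definition dot X Y : R := \tr (X^T *m Y).

Lemma dotE X Y : dot X Y = \sum_i \sum_j X i j * Y i j.
Proof.
rewrite exchange_big; apply: eq_bigr => i _; rewrite mxE.
by apply: eq_bigr => j _; rewrite mxE.
Qed.

Lemma dotC X Y : dot X Y = dot Y X.
Proof. by rewrite /dot -mxtrace_tr trmx_mul trmxK. Qed.

Lemma dotDr X Y Z : dot X (Y + Z) = dot X Y + dot X Z.
Proof. by rewrite /dot mulmxDr mxtraceD. Qed.

Lemma dotDl X Y Z : dot (X + Y) Z = dot X Z + dot Y Z.
Proof. by rewrite !(dotC _ Z) dotDr. Qed.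

Lemma dotZr a X Y : dot X (a *: Y) = a * dot X Y.
Proof. by rewrite /dot -scalemxAr mxtraceZ. Qed.

Lemma dotZl a X Y : dot (a *: X) Y = a * dot X Y.
Proof. by rewrite !(dotC _ Y) dotZr. Qed.

Lemma dotNr X Y : dot X (- Y) = - dot X Y.
Proof. by rewrite -scaleN1r dotZr mulN1r. Qed.

Lemma dotNl X Y : dot (- X) Y = - dot X Y.
Proof. by rewrite !(dotC _ Y) dotNr. Qed.

Lemma dotBr X Y Z : dot X (Y - Z) = dot X Y - dot X Z.
Proof. by rewrite dotDr dotNr. Qed.

Lemma dotBl X Y Z : dot (X - Y) Z = dot X Z - dot Y Z.
Proof. by rewrite dotDl dotNl. Qed.

Lemma dot0r X : dot X 0 = 0.
Proof. by rewrite /dot mulmx0 mxtrace0. Qed.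

Lemma dot0l X : dot 0 X = 0.
Proof. by rewrite dotC dot0r. Qed.

Lemma inner_dot X Y : symm X -> inner X Y = dot X Y.
Proof. by rewrite /inner /dot => ->. Qed.

Lemma dot_ge0 X : 0 <= dot X X.
Proof.
by rewrite dotE sumr_ge0 // => i _; rewrite sumr_ge0 // => j _; rewrite -expr2 sqr_ge0.
Qed.

Lemma frobE X : frob X = Num.sqrt (dot X X).
Proof.
by rewrite dotE /frob; congr Num.sqrt; apply: eq_bigr => i _; apply: eq_bigr => j _; rewrite expr2.
Qed.

Lemma frob_ge0 X : 0 <= frob X.
Proof. exact: sqrtr_ge0. Qed.

Lemma frob_sqr X : frob X ^+ 2 = dot X X.
Proof. by rewrite frobE sqr_sqrtr ?dot_ge0. Qed.

Lemma frob_le X Y : (frob X <= frob Y) = (dot X X <= dot Y Y).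
Proof. by rewrite !frobE ler_sqrt ?dot_ge0. Qed.

Lemma ler_frob_entry X i j : `|X i j| <= frob X.
Proof.
rewrite -ler_sqr ?nnegrE ?frob_ge0 // frob_sqr dotE real_normK ?num_real //.
rewrite (bigD1 i) //= (bigD1 j) //= -expr2 -addrA lerDl addr_ge0 //.
  by rewrite sumr_ge0 // => k _; rewrite -expr2 sqr_ge0.
by rewrite sumr_ge0 // => k _; rewrite sumr_ge0 // => l _; rewrite -expr2 sqr_ge0.
Qed.

Lemma frob_eq0 X : frob X = 0 -> X = 0.
Proof.
move=> X0; apply/matrixP => i j; rewrite mxE; apply/eqP.
by rewrite -normr_le0 -X0 ler_frob_entry.
Qed.

Lemma frob0 : frob (0 : 'M[R]_n) = 0.
Proof. by rewrite frobE dot0r sqrtr0. Qed.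

Lemma frobZ a X : frob (a *: X) = `|a| * frob X.
Proof.
by rewrite !frobE dotZl dotZr mulrA -expr2 sqrtrM ?sqr_ge0 // sqrtr_sqr.
Qed.

Lemma frobN X : frob (- X) = frob X.
Proof. by rewrite -scaleN1r frobZ normrN1 mul1r. Qed.

Lemma frob_distC X Y : frob (X - Y) = frob (Y - X).
Proof. by rewrite -opprB frobN. Qed.

(** Cauchy-Schwarz: with x, y the norms of X, Y, the squared norm of y X - x Y is 2 x y (x y -
    [dot X Y]). *)
Lemma dot_frob_le X Y : dot X Y <= frob X * frob Y.
Proof.
have [X0|X0] := eqVneq (frob X) 0.
  by rewrite (frob_eq0 _ X0) !dot0l frob0 mul0r.
have [Y0|Y0] := eqVneq (frob Y) 0.
  by rewrite (frob_eq0 _ Y0) !dot0r frob0 mulr0.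
have := dot_ge0 (frob Y *: X - frob X *: Y).
rewrite dotBl !dotBr !dotZl !dotZr -!frob_sqr (dotC Y X).
have xy : 0 < frob X * frob Y by rewrite mulr_gt0 // lt0r ?X0 ?Y0 frob_ge0.
move=> h; rewrite -subr_ge0 -(pmulr_rge0 _ xy) mulrBr; move: h.
set x := frob X; set y := frob Y; set d := dot X Y; lra.
Qed.

Lemma normr_dot_le X Y : `|dot X Y| <= frob X * frob Y.
Proof. by rewrite ler_norml dot_frob_le lerNl -dotNl -(frobN X) dot_frob_le. Qed.

Lemma frobD X Y : frob (X + Y) <= frob X + frob Y.
Proof.
rewrite -ler_sqr ?nnegrE ?addr_ge0 ?frob_ge0 // frob_sqr dotDl !dotDr.
rewrite -!frob_sqr (dotC Y X); have := dot_frob_le X Y; lra.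
Qed.

Lemma frobB X Y : frob (X - Y) <= frob X + frob Y.
Proof. by rewrite -(frobN Y) frobD. Qed.

Lemma frob_le_entries c X :
  0 <= c -> (forall i j, `|X i j| <= c) -> frob X <= n%:R * c.
Proof.
move=> c0 Xc; rewrite -ler_sqr ?nnegrE ?mulr_ge0 ?frob_ge0 //.
have -> : (n%:R * c) ^+ 2 = \sum_(i < n) \sum_(j < n) c ^+ 2.
  by rewrite !sumr_const card_ord -mulrnA mulnn exprMn -natrX mulr_natl.
rewrite frob_sqr dotE ler_sum // => i _; rewrite ler_sum // => j _.
by rewrite -expr2 -(real_normK (num_real (X i j))) ler_sqr ?nnegrE.
Qed.

Lemma normr_mulmx_le X Y i j : `|(X *m Y) i j| <= n%:R * (frob X * frob Y).
Proof.
rewrite mxE (le_trans (ler_norm_sum _ _ _)) //.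
rewrite -[in n%:R](card_ord n) mulr_natl -sumr_const ler_sum // => k _.
by rewrite normrM ler_pM // ler_frob_entry.
Qed.

Lemma orth_mulV (Q : 'M[R]_n) : Q^T *m Q = 1%:M -> Q *m Q^T = 1%:M.
Proof. exact: mulmx1C. Qed.

(** The entries of X in the basis formed by the columns of Q, where [opD] acts entrywise. *)
Definition conj_mx (Q X : 'M[R]_n) : 'M[R]_n := Q^T *m X *m Q.

Lemma conjK (Q X : 'M[R]_n) : Q^T *m Q = 1%:M -> Q *m conj_mx Q X *m Q^T = X.
Proof.
move=> /orth_mulV QV.
by rewrite /conj_mx !mulmxA QV mul1mx -mulmxA QV mulmx1.
Qed.

Lemma conjVK (Q X : 'M[R]_n) : Q^T *m Q = 1%:M -> conj_mx Q (Q *m X *m Q^T) = X.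
Proof.
by move=> QV; rewrite /conj_mx !mulmxA QV mul1mx -mulmxA QV mulmx1.
Qed.

Lemma dot_conj (Q X Y : 'M[R]_n) :
  Q^T *m Q = 1%:M -> dot (conj_mx Q X) (conj_mx Q Y) = dot X Y.
Proof.
move=> /orth_mulV QV; rewrite /dot /conj_mx !trmx_mul trmxK mxtrace_mulC.
rewrite !mulmxA -(mulmxA _ Q Q^T) QV mulmx1 mxtrace_mulC !mulmxA QV mul1mx.
by rewrite mxtrace_mulC.
Qed.

Lemma frob_conj (Q X : 'M[R]_n) : Q^T *m Q = 1%:M -> frob (conj_mx Q X) = frob X.
Proof. by move=> QV; rewrite !frobE dot_conj. Qed.

Lemma conjB (Q X Y : 'M[R]_n) : conj_mx Q (X - Y) = conj_mx Q X - conj_mx Q Y.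
Proof. by rewrite /conj_mx mulmxBr mulmxBl. Qed.

Lemma conjD (Q X Y : 'M[R]_n) : conj_mx Q (X + Y) = conj_mx Q X + conj_mx Q Y.
Proof. by rewrite /conj_mx mulmxDr mulmxDl. Qed.

Lemma conjM (Q X Y : 'M[R]_n) :
  Q^T *m Q = 1%:M -> conj_mx Q (X *m Y) = conj_mx Q X *m conj_mx Q Y.
Proof.
by move=> /orth_mulV QV; rewrite /conj_mx !mulmxA -(mulmxA _ Q Q^T) QV mulmx1.
Qed.

Lemma symm_conj (Q X : 'M[R]_n) : symm X -> symm (conj_mx Q X).
Proof. by rewrite /symm /conj_mx !trmx_mul trmxK mulmxA => ->. Qed.

Lemma symm_conjV (Q X : 'M[R]_n) : symm X -> symm (Q *m X *m Q^T).
Proof. by rewrite /symm !trmx_mul trmxK mulmxA => ->. Qed.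

Lemma symmD X Y : symm X -> symm Y -> symm (X + Y).
Proof. by rewrite /symm raddfD /= => -> ->. Qed.

Lemma symmZ a X : symm X -> symm (a *: X).
Proof. by rewrite /symm linearZ /= => ->. Qed.

Lemma symmB X Y : symm X -> symm Y -> symm (X - Y).
Proof. by rewrite /symm raddfB /= => -> ->. Qed.

Lemma symm0 : symm (0 : 'M[R]_n).
Proof. exact: trmx0. Qed.

Lemma symm_entry X i j : symm X -> X i j = X j i.
Proof. by move=> sX; rewrite -[in LHS]sX mxE. Qed.

Definition adherent (S : set 'M[R]_n) Z :=
  forall e : R, 0 < e -> exists2 W, S W & frob (Z - W) < e.

(** A point of S close enough to Z would inherit a negative value of L. Closed equations fit this
    form as well, as nonnegativity of minus a norm. *)
Lemma ge0_adherent (L : 'M[R]_n -> R) c S Z :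
  (forall X Y, `|L X - L Y| <= c * frob (X - Y)) ->
  (forall X, S X -> 0 <= L X) -> adherent S Z -> 0 <= L Z.
Proof.
move=> Lc LS SZ.
have c1 : 0 < `|c| + 1 by rewrite ltr_wpDl.
rewrite leNgt; apply/negP => LZ.
have e0 : 0 < - L Z / (`|c| + 1) by rewrite divr_gt0 ?oppr_gt0.
have [W SW ZW] := SZ _ e0.
rewrite ltr_pdivlMr // in ZW.
have cZW : c * frob (Z - W) <= frob (Z - W) * (`|c| + 1).
  by rewrite mulrC ler_wpM2l ?frob_ge0 // ler_wpDr // ler_norm.
have := Lc W Z; have := LS _ SW; have := ler_norm (L W - L Z).
rewrite (frob_distC W Z); lra.
Qed.

Lemma symm_adherent S Z : (forall X, S X -> symm X) -> adherent S Z -> symm Z.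
Proof.
move=> sS SZ; apply/matrixP => i j; rewrite mxE; apply/eqP.
rewrite -subr_eq0 -normr_le0 -oppr_ge0.
apply: (@ge0_adherent (fun X => - `|X j i - X i j|) 2 S Z) => // [X Y|X SX].
  rewrite -opprD normrN (le_trans (ler_dist_dist _ _)) //.
  have -> : X j i - X i j - (Y j i - Y i j) = (X - Y) j i - (X - Y) i j by rewrite !mxE; ring.
  have := ler_normB ((X - Y) j i) ((X - Y) i j).
  have := ler_frob_entry (X - Y) j i; have := ler_frob_entry (X - Y) i j; lra.
by rewrite (symm_entry _ _ _ (sS _ SX)) subrr normr0 oppr0.
Qed.

Definition nearest (S : set 'M[R]_n) Z P :=
  S P /\ forall W, S W -> frob (Z - P) <= frob (Z - W).

End Frobenius.

(** * Existence and first-order optimality of nearest points *)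

Section NearestPoint.
Context {R : realType} {n : nat}.
Implicit Types (X Y Z W : 'M[R]_n) (S : set 'M[R]_n).

Lemma parallelogram Z X Y :
  dot (X - Y) (X - Y) = 2 * dot (Z - X) (Z - X) + 2 * dot (Z - Y) (Z - Y)
    - 4 * dot (Z - 2^-1 *: (X + Y)) (Z - 2^-1 *: (X + Y)).
Proof.
rewrite !(dotBl, dotBr, dotNl, dotNr, dotDl, dotDr, dotZl, dotZr) (dotC Y X) (dotC X Z) (dotC Y Z).
by field.
Qed.

(* The minimizing points W of S satisfy |W i j - W' i j| <= d + d' for their
   tolerances d, d', so each entry of the limit is a supremum of lower bounds. *)
Lemma nearest_exists S Z :
  S !=set0 -> (forall X Y, S X -> S Y -> S (2^-1 *: (X + Y))) ->
  (forall X, adherent S X -> S X) -> exists P, nearest S Z P.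
Proof.
move=> [W0 SW0] midS clS.
pose D := [set frob (Z - W) | W in S].
have D0 : D !=set0 by exists (frob (Z - W0)), W0.
have lbD : has_lbound D by exists 0 => _ [W _ <-]; exact: frob_ge0.
have dle W : S W -> inf D <= frob (Z - W) by move=> SW; apply: ge_inf => //; exists W.
have d0 : 0 <= inf D by apply: lb_le_inf => // _ [W _ <-]; exact: frob_ge0.
have infD (e : R) (e0 : 0 < e) := inf_adherent e0 (conj D0 lbD).
move: (inf D) dle d0 infD => d dle d0 infD.
(* With the excess e^2 / 2, [parallelogram] gives |W - W'|^2 <= e^2 + e'^2 <= (e + e')^2, because
   the midpoint is at distance at least d. *)
pose near (e : R) W := S W /\ dot (Z - W) (Z - W) < d ^+ 2 + e ^+ 2 / 2.
have near_ex (e : R) : 0 < e -> exists W, near e W.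
  move=> e0; have e2 : 0 < e ^+ 2 / 2 by rewrite divr_gt0 ?exprn_gt0.
  have s0 : 0 <= d ^+ 2 + e ^+ 2 / 2 by rewrite addr_ge0 ?sqr_ge0 // ltW.
  have gap : 0 < Num.sqrt (d ^+ 2 + e ^+ 2 / 2) - d.
    by rewrite subr_gt0 -[ltLHS]ger0_norm // -sqrtr_sqr ltr_sqrt ?ltrDl // ltr_wpDl ?sqr_ge0.
  have [_ [W SW <-]] := infD _ gap; rewrite addrCA subrr addr0 => Wlt.
  exists W; split => //.
  by rewrite -frob_sqr -[ltRHS]sqr_sqrtr // ltr_sqr ?nnegrE ?sqrtr_ge0 ?frob_ge0.
have near_close (e e' : R) W W' i j : 0 < e -> 0 < e' -> near e W -> near e' W' ->
    `|W i j - W' i j| <= e + e'.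
  move=> e0 e0' [SW Wd] [SW' Wd'].
  have -> : W i j - W' i j = (W - W') i j by rewrite !mxE.
  rewrite (le_trans (ler_frob_entry _ _ _)) // -ler_sqr ?nnegrE ?frob_ge0 ?addr_ge0 ?ltW //.
  rewrite frob_sqr (parallelogram Z).
  have : d ^+ 2 <= dot (Z - 2^-1 *: (W + W')) (Z - 2^-1 *: (W + W')).
    by rewrite -frob_sqr ler_sqr ?nnegrE ?frob_ge0 // dle //; exact: midS.
  have : 0 < e * e' by rewrite mulr_gt0.
  move: Wd Wd'; set a := dot _ _; set b := dot _ _; set c := dot _ _; lra.
pose E i j := [set x : R | exists (e : R) W, [/\ 0 < e, near e W & x = W i j - e]].
pose L : 'M[R]_n := \matrix_(i, j) sup (E i j).
have ubE i j (e : R) W : 0 < e -> near e W -> ubound (E i j) (W i j + e).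
  move=> e0 nW _ [e' [W' [e0' nW' ->]]].
  have := near_close _ _ _ _ i j e0' e0 nW' nW.
  have := ler_norm (W' i j - W i j); lra.
have Lnear (e : R) W : 0 < e -> near e W -> frob (W - L) <= n%:R * e.
  move=> e0 nW; apply: frob_le_entries; first exact: ltW.
  move=> i j; rewrite !mxE ler_distl; apply/andP; split.
    rewrite lerBlDr; apply: ge_sup; last exact: ubE.
    by exists (W i j - e), e, W.
  rewrite -lerBlDr; apply: ub_le_sup; last by exists e, W.
  by exists (W i j + e); exact: ubE.
have n1 : 0 < n%:R + 1 :> R by rewrite ltr_wpDl.
(* The share e / (n + 1) pays for the distance from Z to a near point, and n times it for the
   passage from that point to [L]. *)
have split_e (e : R) : e = e / (n%:R + 1) + n%:R * (e / (n%:R + 1)).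
  by field; rewrite gt_eqF.
have nlt (e : R) : 0 < e -> n%:R * (e / (n%:R + 1)) < e.
  by move=> e0; rewrite [ltRHS]split_e ltrDr divr_gt0.
exists L; split=> [|W SW].
  apply: clS => e e0; have e1 : 0 < e / (n%:R + 1) by rewrite divr_gt0.
  have [W nW] := near_ex _ e1; exists W; first by case: nW.
  by rewrite frob_distC (le_lt_trans (Lnear _ _ e1 nW)) ?nlt.
suff le_e (e : R) : 0 < e -> frob (Z - L) <= d + e.
  by apply: le_trans (dle _ SW); apply/ler_addgt0Pr => e /le_e.
move=> e0.
have e1 : 0 < e / (n%:R + 1) by rewrite divr_gt0.
have [W' nW'] := near_ex _ e1.
have -> : Z - L = (Z - W') + (W' - L) by rewrite addrA subrK.
apply: le_trans (frobD _ _) _.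
rewrite [e]split_e addrA lerD ?Lnear //; case: nW' => _ Wd.
have de : 0 <= d + e / (n%:R + 1) by rewrite addr_ge0 // ltW.
rewrite -ler_sqr ?nnegrE ?frob_ge0 // frob_sqr (le_trans (ltW Wd)) //.
rewrite sqrrD; have := mulr_ge0 d0 (ltW e1); have := sqr_ge0 (e / (n%:R + 1)).
set x := e / _; lra.
Qed.

Lemma nearest_proj S Z :
  (exists P, nearest S Z P) -> nearest S Z (proj_onto S Z).
Proof. exact: xgetPex. Qed.

Lemma ge0_of_quadratic (a b : R) :
  (forall t : R, 0 < t -> t <= 1 -> 0 <= t * a + t ^+ 2 * b) -> 0 <= a.
Proof.
move=> h; rewrite leNgt; apply/negP => a0.
have s0 : 0 < - a + `|b| + 1 by rewrite ltr_wpDl // addr_ge0 // oppr_ge0 ltW.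
(* This t lies in (0, 1] and satisfies t |b| < - a, so that a + t b < 0. *)
pose t := - a / (- a + `|b| + 1).
have t0 : 0 < t by rewrite divr_gt0 ?oppr_gt0.
have t1 : t <= 1 by rewrite ler_pdivrMr // mul1r -addrA lerDl addr_ge0.
have := h _ t0 t1; rewrite expr2 -mulrA -mulrDr pmulr_rge0 // => ab.
have tE : t * (- a + `|b| + 1) = - a by rewrite divfK // gt_eqF.
have tb : t * b <= t * `|b| by rewrite ler_wpM2l ?ler_norm // ltW.
have ta : 0 < t * - a by rewrite mulr_gt0 ?oppr_gt0.
move: tE; rewrite !mulrDr mulr1; lra.
Qed.

(** Feasibility is asked along a single direction only, so that the lemma serves both the psd cone
    and the subspace [fixM]. *)
Lemma nearest_variation S Z P (V : 'M[R]_n) :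
  nearest S Z P -> (forall t : R, 0 < t -> t <= 1 -> S (P + t *: V)) ->
  0 <= dot (P - Z) V.
Proof.
move=> [_ nP] SV; rewrite -(pmulr_rge0 _ (ltr0Sn R 1)).
apply: (@ge0_of_quadratic _ (dot V V)) => t t0 t1.
have := nP _ (SV _ t0 t1); rewrite frob_le.
have -> : Z - (P + t *: V) = (Z - P) - t *: V by rewrite opprD addrA.
rewrite -(opprB P Z); move: (P - Z) => N.
rewrite !(dotBl, dotBr, dotNl, dotNr, dotZl, dotZr) (dotC V N).
by set x := dot N N; set y := dot N V; set z := dot V V; lra.
Qed.

End NearestPoint.

(** * The psd cone and the Moreau decomposition *)

Section PsdProjection.
Context {R : realType} {n : nat}.
Implicit Types (X Y Z W P N : 'M[R]_n).

Lemma quad_dot X (v : 'cV[R]_n) : (v^T *m X *m v) 0 0 = dot (v *m v^T) X.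
Proof.
by rewrite -trace_mx11 /dot trmx_mul trmxK -(mulmxA v) [RHS]mxtrace_mulC.
Qed.

Lemma psd0 : psd (0 : 'M[R]_n).
Proof. by split=> [|v]; [exact: symm0 | rewrite quad_dot dot0r]. Qed.

Lemma psdD X Y : psd X -> psd Y -> psd (X + Y).
Proof.
move=> [sX pX] [sY pY]; split=> [|v]; first exact: symmD.
by have := pX v; have := pY v; rewrite !quad_dot dotDr => *; rewrite addr_ge0.
Qed.

Lemma psdZ (a : R) X : 0 <= a -> psd X -> psd (a *: X).
Proof.
move=> a0 [sX pX]; split=> [|v]; first exact: symmZ.
by have := pX v; rewrite !quad_dot dotZr => *; rewrite mulr_ge0.
Qed.

Lemma psd_congr X (T : 'M[R]_n) : psd X -> psd (T *m X *m T^T).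
Proof.
move=> [sX pX]; split=> [|v]; first exact: symm_conjV.
by have := pX (T^T *m v); rewrite trmx_mul trmxK !mulmxA.
Qed.

Lemma psd_rank1 (v : 'cV[R]_n) : psd (v *m v^T).
Proof.
split=> [|w]; first by rewrite /symm trmx_mul trmxK.
have -> : w^T *m (v *m v^T) *m w = (w^T *m v) *m (w^T *m v)^T.
  by rewrite trmx_mul trmxK !mulmxA.
by rewrite mxE big_ord1 [(w^T *m v)^T 0 0]mxE -expr2 sqr_ge0.
Qed.

Lemma psd_adherent X : adherent (@psd R n) X -> psd X.
Proof.
move=> aX; split=> [|v]; first by apply: symm_adherent aX => Y [].
rewrite quad_dot; apply: (@ge0_adherent _ _ (dot (v *m v^T)) (frob (v *m v^T))) aX => Y.
  by move=> W; rewrite -dotBr normr_dot_le.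
by move=> [_ /(_ v)]; rewrite quad_dot.
Qed.

(* Characterizes P as the projection of Z: P and P - Z are the two orthogonal
   pieces of the Moreau decomposition of Z (the psd cone is self-dual). *)
Definition moreau Z P :=
  [/\ psd P, dot P (P - Z) = 0 & forall W, psd W -> 0 <= dot (P - Z) W].

(** The feasible directions are every psd W, in particular P, and also - P, because (1 - t) P stays
    psd for t <= 1. *)
Lemma nearest_moreau Z P : nearest (@psd R n) Z P -> moreau Z P.
Proof.
move=> nP; have [pP _] := nP; split=> // [|W pW]; last first.
  by apply: (nearest_variation _ _ _ _ nP) => t t0 _; apply/psdD/psdZ => //; exact: ltW.
apply/eqP; rewrite eq_le dotC; apply/andP; split; last first.
  by apply: (nearest_variation _ _ _ _ nP) => t t0 _; apply/psdD/psdZ => //; exact: ltW.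
rewrite -oppr_ge0 -dotNr; apply: (nearest_variation _ _ _ _ nP) => t t0 t1.
have -> : P + t *: - P = (1 - t) *: P by rewrite scalerN scalerBl scale1r.
by apply: psdZ => //; rewrite subr_ge0.
Qed.

Lemma proj_psd_moreau Z : moreau Z (proj_psd Z).
Proof.
apply/nearest_moreau/nearest_proj/nearest_exists.
- by exists 0; exact: psd0.
- by move=> X Y pX pY; apply/psdZ/psdD; rewrite ?invr_ge0.
- exact: psd_adherent.
Qed.

(* Test the dual inequality on the psd matrices (1 + t K) P (1 + t K)^T. *)
Lemma moreau_mul0 Z P : symm Z -> moreau Z P -> P *m (P - Z) = 0.
Proof.
move=> sZ [pP PN NW]; have [sP _] := pP.
have sN : symm (P - Z) by exact: symmB.
move: (P - Z) sN PN NW => N sN PN NW.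
have NKP K : 0 <= dot N (K *m P).
  rewrite -(pmulr_rge0 _ (ltr0Sn R 1)).
  apply: (@ge0_of_quadratic _ _ (dot N (K *m P *m K^T))) => t t0 _.
  have := NW _ (psd_congr _ (1%:M + t *: K) pP).
  rewrite raddfD /= trmx1 linearZ /= mulmxDl mul1mx mulmxDr mulmx1 mulmxDl.
  rewrite -!scalemxAl -!scalemxAr.
  have -> : dot N (P + t *: (K *m P) + (t *: (P *m K^T) + t *: (t *: (K *m P *m K^T))))
    = dot P N + t * dot N (K *m P) + t * dot N (P *m K^T) + t ^+ 2 * dot N (K *m P *m K^T).
    by rewrite !dotDr !dotZr (dotC P N); ring.
  have -> : dot N (P *m K^T) = dot N (K *m P).
    by rewrite /dot -mxtrace_tr !trmx_mul !trmxK sP sN mxtrace_mulC.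
  by rewrite PN; set x := dot _ _; set y := dot _ _; lra.
(* Exchanging K for - K turns the inequality into an equality; K = N P then yields the squared norm
   of P N. *)
have NKP0 K : dot N (K *m P) = 0.
  by apply/eqP; rewrite eq_le NKP -oppr_ge0 -dotNr -mulNmx NKP.
apply: frob_eq0; apply/eqP; rewrite -sqrf_eq0 frob_sqr; apply/eqP.
rewrite -(NKP0 (N *m P)) /dot trmx_mul sN sP -!mulmxA.
by rewrite [RHS]mxtrace_mulC -!mulmxA mxtrace_mulC -!mulmxA.
Qed.

(** With N = P - Z and N' = P' - Z', the inner product of P - P' and N - N' is - [dot P N'] -
    [dot P' N], hence nonpositive. *)
Lemma moreau_firm Z P Z' P' : moreau Z P -> moreau Z' P' ->
  frob (P - P') ^+ 2 + frob ((P - Z) - (P' - Z')) ^+ 2 <= frob (Z - Z') ^+ 2.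
Proof.
move=> [pP PN NW] [pP' PN' NW']; rewrite !frob_sqr.
have := NW _ pP'; have := NW' _ pP.
have -> : Z - Z' = (P - P') - ((P - Z) - (P' - Z')).
  by rewrite !opprB !addrA; apply/matrixP => i j; rewrite !mxE; ring.
move: (P - Z) (P' - Z') PN PN' => N N' PN PN'.
rewrite !(dotBl, dotBr) (dotC N' P) (dotC N P') (dotC N P) (dotC N' P') PN PN'.
lra.
Qed.

Lemma moreau_nonexp Z P Z' P' : moreau Z P -> moreau Z' P' ->
  frob (P - P') <= frob (Z - Z') /\
  frob ((P - Z) - (P' - Z')) <= frob (Z - Z').
Proof.
move=> m m'; have := moreau_firm _ _ _ _ m m'.
have := sqr_ge0 (frob (P - P')); have := sqr_ge0 (frob ((P - Z) - (P' - Z'))).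
by move=> h1 h2 h3; split; rewrite -ler_sqr ?nnegrE ?frob_ge0 //; lra.
Qed.

(** Computing a projection is thereby reduced to exhibiting a Moreau decomposition. *)
Lemma moreau_unique Z P : moreau Z P -> proj_psd Z = P.
Proof.
move=> /(moreau_nonexp _ _ _ _ (proj_psd_moreau Z)) [+ _].
rewrite subrr frob0 => h; apply/eqP; rewrite -subr_eq0; apply/eqP/frob_eq0/eqP.
by rewrite eq_le h frob_ge0.
Qed.

End PsdProjection.

(** * Positivity by diagonal dominance on a block *)

Section BlockPositivity.
Context {R : realType} {n : nat}.
Implicit Types (W T : 'M[R]_n).

Lemma quad_delta W i j :
  ((delta_mx i 0 : 'cV[R]_n)^T *m W *m (delta_mx j 0 : 'cV[R]_n)) 0 0 = W i j.
Proof. by rewrite trmx_delta -rowE -colE !mxE. Qed.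

Lemma psd_diag_ge0 W i : psd W -> 0 <= W i i.
Proof. by move=> [_ /(_ (delta_mx i 0))]; rewrite quad_delta. Qed.

(** The quadratic form is tested on e_i + e_j and e_i - e_j. *)
Lemma psd_entry_le W i j : psd W -> `|W i j| <= (W i i + W j j) / 2.
Proof.
move=> [sW pW].
have q (s : R) : 0 <= W i i + s * W j i + s * (W i j + s * W j j).
  have := pW (delta_mx i 0 + s *: delta_mx j 0).
  rewrite [(_ + _)^T]raddfD /= [(_ *: _)^T]linearZ /= !(mulmxDl, mulmxDr).
  rewrite -!scalemxAl -!scalemxAr.
  have addE (X Y : 'M[R]_1) : (X + Y) 0 0 = X 0 0 + Y 0 0 by rewrite mxE.
  have scaleE (a : R) (X : 'M[R]_1) : (a *: X) 0 0 = a * X 0 0 by rewrite mxE.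
  rewrite !(addE, scaleE).
  by rewrite !quad_delta mulrDr.
rewrite ler_norml; have := q 1; have := q (-1); rewrite (symm_entry _ j i sW).
by move=> q1 q2; apply/andP; split; lra.
Qed.

(* Diagonal dominance replaces a spectral square root of T: the entries of a
   psd matrix satisfy |W i j| <= (W i i + W j j) / 2. *)
Lemma block_dot_ge0 (I : pred 'I_n) (mu e : R) T W :
  (forall i j, ~~ (I i && I j) -> T i j = 0) ->
  (forall i j, i != j -> `|T i j| <= e) ->
  (forall i, I i -> mu - e <= T i i) ->
  0 <= e -> n%:R * e <= mu -> psd W -> 0 <= dot T W.
Proof.
move=> T0 Toff Tdiag e0 ne pW; pose w i := if I i then W i i else 0.
have w0 i : 0 <= w i by rewrite /w; case: ifP => // _; exact: psd_diag_ge0.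
(* The loss e / 2 (w i + w j) is charged on and off the diagonal alike, so the lower bounds add up
   to (mu - n e) times the sum of [w]. *)
have TW i j : (if i == j then mu * w i else 0) - e / 2 * (w i + w j) <= T i j * W i j.
  have [<-|nij] := eqVneq i j.
    rewrite /w; case: ifP => Ii; last by rewrite T0 ?Ii //; lra.
    have := ler_wpM2r (psd_diag_ge0 _ i pW) (Tdiag _ Ii); lra.
  have ew : 0 <= e / 2 * (w i + w j) by rewrite mulr_ge0 ?addr_ge0 ?divr_ge0.
  have [/andP[Ii Ij]|nI] := boolP (I i && I j); last by rewrite T0 // mul0r; lra.
  have : `|T i j * W i j| <= e * ((W i i + W j j) / 2).
    by rewrite normrM ler_pM // ?Toff // psd_entry_le.
  by rewrite ler_norml /w Ii Ij => /andP[+ _]; lra.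
rewrite dotE; apply: le_trans (ler_sum _ (fun i _ => ler_sum _ (fun j _ => TW i j))).
have -> : \sum_i \sum_j ((if i == j then mu * w i else 0) - e / 2 * (w i + w j))
    = (mu - n%:R * e) * \sum_i w i.
  under eq_bigr => i _.
    rewrite sumrB -big_mkcond (eq_bigl (pred1 i)); last by move=> j; rewrite /= eq_sym.
    rewrite big_pred1_eq -mulr_sumr big_split /= sumr_const card_ord -[_ *+ n]mulr_natl.
    over.
  rewrite sumrB -!mulr_sumr big_split /= -mulr_sumr sumr_const card_ord -[_ *+ n]mulr_natl.
  by field.
by rewrite mulr_ge0 ?subr_ge0 ?sumr_ge0.
Qed.

End BlockPositivity.

(** * The psd projection near a nonsingular matrix *)

Section Spectral.
Context {R : realType} {n : nat}.
Variables (Q : 'M[R]_n) (lam : 'I_n -> R) (r : nat) (mu : R).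
Hypothesis QV : Q^T *m Q = 1%:M.
Hypothesis mu_gt0 : 0 < mu.
Hypothesis lam_pos : forall i : 'I_n, (i < r)%N -> mu <= lam i.
Hypothesis lam_neg : forall i : 'I_n, (r <= i)%N -> lam i <= - mu.
Implicit Types (H V W Z : 'M[R]_n).

Definition lamp (i : 'I_n) : R := if (i < r)%N then lam i else 0.

Notation Zs := (Q *m diag_mx (\row_i lam i) *m Q^T).
Notation Xs := (Q *m diag_mx (\row_i lamp i) *m Q^T).
Notation D := (opD Q lam r).

(** Indexed by both booleans, so that one case analysis reduces every test in [Omega] and supplies
    the quantitative sign of the eigenvalue. *)
Variant sign_spec (i : 'I_n) : bool -> bool -> Type :=
 | SignPos of mu <= lam i : sign_spec i true false
 | SignNeg of lam i <= - mu : sign_spec i false true.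

Lemma signP i : sign_spec i (i < r)%N (r <= i)%N.
Proof. by case: ltnP => h; constructor; [exact: lam_pos | exact: lam_neg]. Qed.

Lemma OmegaC i j : Omega lam r i j = Omega lam r j i.
Proof. by rewrite !mxE; case: (signP i) => _; case: (signP j). Qed.

Lemma Omega_ge0 i j : 0 <= Omega lam r i j.
Proof.
rewrite !mxE; move: mu_gt0; case: (signP i) => hi; case: (signP j) => hj //= m0;
  apply: divr_ge0; lra.
Qed.

Lemma Omega_le1 i j : Omega lam r i j <= 1.
Proof.
rewrite !mxE; move: mu_gt0; case: (signP i) => hi; case: (signP j) => hj //= m0;
  rewrite ler_pdivrMr; lra.
Qed.

(** On mixed entries [Omega] is a ratio strictly between 0 and 1, whereas it is 1 or 0 on the pure
    blocks. This strictness forces fixed directions to vanish on the mixed blocks. *)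
Lemma Omega_mixed (i j : 'I_n) : (i < r)%N != (j < r)%N ->
  0 < Omega lam r i j * (1 - Omega lam r i j).
Proof.
move=> ij; apply: mulr_gt0; rewrite ?subr_gt0.
  rewrite !mxE; move: mu_gt0 ij.
  case: (signP i) => hi; case: (signP j) => hj //= m0 _; apply: divr_gt0; lra.
rewrite !mxE; move: mu_gt0 ij.
case: (signP i) => hi; case: (signP j) => hj //= m0 _; rewrite ltr_pdivrMr; lra.
Qed.

Lemma conj_mx_opD H : conj_mx Q (D H) = hadamard (Omega lam r) (conj_mx Q H).
Proof. by rewrite /opD conjVK. Qed.

Lemma opDB H V : D (H - V) = D H - D V.
Proof.
rewrite /opD -mulmxBl -mulmxBr; congr (_ *m _ *m _); rewrite -/(conj_mx Q _) conjB.
by apply/matrixP => i j; rewrite !mxE mulrBr.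
Qed.

Lemma opD0 : D 0 = 0.
Proof. by have := opDB 0 0; rewrite subr0 subrr. Qed.

Lemma opDZ (a : R) H : D (a *: H) = a *: D H.
Proof.
rewrite /opD scalemxAl scalemxAr; congr (_ *m _ *m _).
by rewrite -scalemxAr -scalemxAl; apply/matrixP => i j; rewrite !mxE mulrCA.
Qed.

Lemma frob_opD_le H : frob (D H) <= frob H.
Proof.
rewrite -(frob_conj Q (D H)) // conj_mx_opD -(frob_conj Q H) // frob_le !dotE.
rewrite ler_sum // => i _; rewrite ler_sum // => j _; rewrite [hadamard _ _ _ _]mxE.
rewrite -!expr2 exprMn ler_piMl ?sqr_ge0 // expr_le1 ?Omega_le1 ?Omega_ge0 //.
Qed.

Lemma dot_conjV T W : dot (Q *m T *m Q^T) W = dot T (conj_mx Q W).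
Proof. by rewrite -(dot_conj Q) // conjVK. Qed.

(* Perturbing Zs by a small V without mixed block keeps the positive and the
   negative part in their blocks, so the projection moves exactly by D V. *)
Lemma moreau_block V : symm V ->
  (forall i j : 'I_n, (i < r)%N != (j < r)%N -> conj_mx Q V i j = 0) ->
  n%:R * frob V <= mu -> moreau (Zs + V) (Xs + D V).
Proof.
move=> sV V0 nV; set v := conj_mx Q V.
have vV i j : `|v i j| <= frob V by rewrite -(frob_conj Q V) // ler_frob_entry.
pose T : 'M[R]_n := diag_mx (\row_i lamp i) + hadamard (Omega lam r) v.
have Tij i j : T i j = lamp i *+ (i == j) + Omega lam r i j * v i j by rewrite !mxE.
have XT : Xs + D V = Q *m T *m Q^T by rewrite /opD mulmxDr mulmxDl.
(* In eigencoordinates the perturbed matrix is [T - U]; [T] lives on the positive block, and [U] is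
   minus the negative block. *)
pose U : 'M[R]_n := T - (diag_mx (\row_i lam i) + v).
have Uij i j : U i j = T i j - (lam i *+ (i == j) + v i j) by rewrite !mxE.
have ZU : Zs + V = Q *m T *m Q^T - Q *m U *m Q^T.
  by rewrite -mulmxBl -mulmxBr /U subKr mulmxDr mulmxDl conjK.
have sv : symm v by exact: symm_conj.
rewrite XT {XT}ZU; rewrite -/v in V0; clearbody U; clearbody T v.
have sT : symm (Q *m T *m Q^T).
  apply: symm_conjV; apply/matrixP => i j; rewrite mxE 2!Tij OmegaC.
  rewrite (symm_entry v j i sv) eq_sym.
  by have [->|//] := eqVneq i j.
have TP (i j : 'I_n) : ~~ ((i < r) && (j < r))%N -> T i j = 0.
  rewrite Tij /lamp; have := V0 i j; rewrite [Omega _ _ _ _]mxE.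
  case: (eqVneq i j) => [<-|_]; case: (signP i) => // _;
    [|case: (signP j) => // _..]; rewrite /= ?mul0rn ?mul0r ?addr0 //;
    by move=> -> //; rewrite mulr0 // addr0.
have UP (i j : 'I_n) : ~~ ((r <= i) && (r <= j))%N -> U i j = 0.
  rewrite Uij Tij /lamp; have := V0 i j; rewrite [Omega _ _ _ _]mxE.
  case: (eqVneq i j) => [<-|_]; case: (signP i) => // _;
    [|case: (signP j) => // _..]; rewrite /= ?mul1r ?subrr ?mulr0n ?add0r ?subrr //;
    by move=> -> //; rewrite mulr0 // subrr.
have frobV0 := frob_ge0 V.
have TW W : psd W -> 0 <= dot (Q *m T *m Q^T) W.
  move=> pW; rewrite dot_conjV.
  apply: (block_dot_ge0 (fun i : 'I_n => (i < r)%N) mu (frob V)) => //.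
  - move=> i j nij; rewrite Tij (negPf nij) mulr0n add0r normrM.
    by rewrite (ger0_norm (Omega_ge0 _ _)) (le_trans (ler_piMl _ (Omega_le1 _ _))).
  - move=> i ir; rewrite Tij eqxx mulr1n /lamp ir [Omega _ _ _ _]mxE ir mul1r.
    by have := vV i i; rewrite ler_norml => /andP[+ _]; have := lam_pos _ ir; lra.
  - by have := psd_congr _ Q^T pW; rewrite trmxK.
have UW W : psd W -> 0 <= dot (Q *m U *m Q^T) W.
  move=> pW; rewrite dot_conjV.
  apply: (block_dot_ge0 (fun i : 'I_n => (r <= i)%N) mu (frob V)) => //.
  - move=> i j nij; rewrite Uij Tij (negPf nij) !mulr0n !add0r.
    rewrite -[X in _ - X]mul1r -mulrBl normrM distrC (@ger0_norm _ (1 - _)) ?subr_ge0 ?Omega_le1 //.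
    by apply: le_trans (vV i j); apply: ler_piMl => //; rewrite gerBl Omega_ge0.
  - move=> i ri; rewrite Uij Tij eqxx !mulr1n /lamp [Omega _ _ _ _]mxE !ltnNge ri /= mul0r.
    by have := vV i i; rewrite ler_norml => /andP[_ +]; have := lam_neg _ ri; lra.
  - by have := psd_congr _ Q^T pW; rewrite trmxK.
split.
- by split=> // w; rewrite quad_dot dotC TW //; exact: psd_rank1.
- rewrite subKr dot_conjV conjVK // dotE big1 // => i _; rewrite big1 // => j _.
  case: (boolP ((i < r) && (j < r))%N) => [/andP[ir _]|/TP ->]; last by rewrite mul0r.
  by rewrite UP ?mulr0 // leqNgt ir.
- by move=> W; rewrite subKr; exact: UW.
Qed.

Lemma moreau_center : moreau Zs Xs.
Proof.
have := moreau_block 0 symm0; rewrite opD0 !addr0; apply=> [i j _|]; first by rewrite /conj_mx mulmx0 mul0mx mxE.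
by rewrite frob0 mulr0 ltW.
Qed.

(** The factor n^2 comes from bounding entries. It is harmless: such constants only affect how close
    to the limit the contraction sets in. *)
Lemma frob_mulmx_le (X Y : 'M[R]_n) : frob (X *m Y) <= n%:R ^+ 2 * (frob X * frob Y).
Proof.
rewrite expr2 -mulrA; apply: frob_le_entries => [|i j]; last exact: normr_mulmx_le.
by rewrite !mulr_ge0 ?frob_ge0.
Qed.

Lemma norm_le_div (d x e : R) : mu <= d -> d * x = e -> `|x| <= `|e| / mu.
Proof.
move=> md <-; rewrite ler_pdivlMr // normrM mulrC ler_wpM2r //.
exact: le_trans (ler_norm _).
Qed.

Lemma symm_center : symm Zs.
Proof. by apply: symm_conjV; rewrite /symm tr_diag_mx. Qed.

(* Linearizing P (P - Z) = 0 at Zs gives a decoupled Sylvester equation for the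
   increment of the projection; the error is controlled by nonexpansiveness. *)
Lemma proj_psd_strict_diff Z Z' : symm Z -> symm Z' ->
  frob (proj_psd Z - proj_psd Z' - D (Z - Z')) <=
  n%:R ^+ 3 / mu * (frob (Z - Zs) + frob (Z' - Zs)) * frob (Z - Z').
Proof.
move=> sZ sZ'.
have m := proj_psd_moreau Z; have m' := proj_psd_moreau Z'.
move: (proj_psd Z) (proj_psd Z') m m' => P P' m m'.
have ms := moreau_center.
have PN := moreau_mul0 _ _ sZ m; have PN' := moreau_mul0 _ _ sZ' m'.
have [[sP _] _ _] := m; have [[sP' _] _ _] := m'.
have [dP dN] := moreau_nonexp _ _ _ _ m m'.
have [_ dNs] := moreau_nonexp _ _ _ _ ms m.
have [dPs _] := moreau_nonexp _ _ _ _ ms m'.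
(* Each summand is a product of two small factors. Expanding, P (P - Z) and P' (P' - Z') vanish and
   the mixed terms cancel, which leaves an expression linear in the increments. *)
pose E := (P - P') *m ((Xs - Zs) - (P - Z)) + (Xs - P') *m ((P - Z) - (P' - Z')).
have EE : E = (P - P') *m (Xs - Zs) + Xs *m ((P - P') - (Z - Z')).
  have -> : (P - P') - (Z - Z') = (P - Z) - (P' - Z').
    by rewrite !opprB !addrA; apply/matrixP => i j; rewrite !mxE; ring.
  rewrite /E mulmxBr (mulmxBl P P' (P - Z)) PN sub0r opprK (mulmxBl Xs P').
  by rewrite (mulmxBr P' (P - Z)) PN' subr0 -addrA [P' *m _ + _]addrC subrK.
have Ele : frob E <= n%:R ^+ 2 * ((frob (Z - Zs) + frob (Z' - Zs)) * frob (Z - Z')).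
  rewrite (le_trans (frobD _ _)) // mulrDl mulrDr lerD // (le_trans (frob_mulmx_le _ _)) //;
    rewrite ler_wpM2l ?sqr_ge0 //.
    by rewrite mulrC ler_pM ?frob_ge0 // (frob_distC Z).
  by rewrite ler_pM ?frob_ge0 // (frob_distC Z').
rewrite -(frob_conj Q) // conjB conj_mx_opD.
set p := conj_mx Q (P - P'); set w := conj_mx Q (Z - Z').
have cE i j : conj_mx Q E i j = p i j * (lamp j - lam j) + lamp i * (p i j - w i j).
  rewrite EE conjD (conjM _ (P - P')) // (conjM _ Xs) // (conjB _ Xs) (conjB _ (P - P')) !conjVK // -/p -/w.
  rewrite mulmxBr !mul_mx_diag mul_diag_mx; clearbody p w.
  by rewrite !mxE -mulrBr.
have eE i j : `|conj_mx Q E i j| / mu <= frob E / mu.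
  by rewrite ler_pM2r ?invr_gt0 // -(frob_conj Q E) // ler_frob_entry.
(* For i negative and j positive the (i, j) equation has only zero coefficients; the transposed
   entry and symmetry replace it. *)
have pC i j : p i j = p j i by apply/symm_entry/symm_conj/symmB.
have wC i j : w i j = w j i by apply/symm_entry/symm_conj/symmB.
clearbody p w; have ple i j : `|(p - hadamard (Omega lam r) w) i j| <= frob E / mu.
  have hij := cE i j; have hji := cE j i; have mu0 := mu_gt0.
  have ij := eE i j; have ji := eE j i.
  rewrite !mxE.
  move: hij hji ij ji; rewrite /lamp (pC j i) (wC j i).
  case: (signP i) => hi; case: (signP j) => hj /= hij hji ij ji.
  - apply: le_trans ij; apply: (norm_le_div (lam i)) => //; rewrite hij; ring.
  - apply: le_trans ij; apply: (norm_le_div (lam i - lam j)); first lra.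
    by rewrite hij; field; rewrite gt_eqF //; lra.
  - apply: le_trans ji; apply: (norm_le_div (lam j - lam i)); first lra.
    by rewrite hji; field; rewrite gt_eqF //; lra.
  - apply: le_trans ij; apply: (norm_le_div (- lam j)); first lra.
    rewrite hij; ring.
apply: le_trans (frob_le_entries _ _ _ ple) _; first by rewrite divr_ge0 ?frob_ge0 // ltW.
have -> : n%:R ^+ 3 / mu * (frob (Z - Zs) + frob (Z' - Zs)) * frob (Z - Z') =
  n%:R * (n%:R ^+ 2 * ((frob (Z - Zs) + frob (Z' - Zs)) * frob (Z - Z')) / mu).
  by rewrite exprS; ring.
by rewrite ler_wpM2l // ler_pM2r ?invr_gt0.
Qed.

End Spectral.

(** * The projection onto the range of the adjoint, and the ADMM map *)

Section RangeProjection.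
Context {R : realType} {n m : nat}.
Variable A : 'I_m -> 'M[R]_n.
Hypothesis symA : forall i, symm (A i).
Hypothesis surjA : forall b' : 'cV[R]_m, exists X, symm X /\ opA A X = b'.
Implicit Types (X Y H : 'M[R]_n) (y : 'cV[R]_m).

Lemma opAE X i : opA A X i 0 = dot (A i) X.
Proof. by rewrite mxE inner_dot. Qed.

Lemma opAD X Y : opA A (X + Y) = opA A X + opA A Y.
Proof. by apply/colP => i; rewrite [RHS]mxE !opAE dotDr. Qed.

Lemma opAZ (a : R) X : opA A (a *: X) = a *: opA A X.
Proof. by apply/colP => i; rewrite [RHS]mxE !opAE dotZr. Qed.

Lemma opAtD y y' : opAt A (y + y') = opAt A y + opAt A y'.
Proof.
by rewrite /opAt -big_split; apply: eq_bigr => i _; rewrite mxE scalerDl.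
Qed.

Lemma opAtZ (a : R) y : opAt A (a *: y) = a *: opAt A y.
Proof. by rewrite /opAt scaler_sumr; apply: eq_bigr => i _; rewrite mxE scalerA. Qed.

Lemma symm_opAt y : symm (opAt A y).
Proof.
by rewrite /opAt; elim/big_ind: _ => [|X Y|i _]; [exact: symm0 | exact: symmD | exact: symmZ].
Qed.

Lemma dot_opAt y X : dot (opAt A y) X = (y^T *m opA A X) 0 0.
Proof.
rewrite mxE /opAt (big_morph (dot^~ X) (fun U V => dotDl U V X) (dot0l X)).
by apply: eq_bigr => i _; rewrite dotZl opAE [y^T _ _]mxE.
Qed.

Lemma opA_opAt y : opA A (opAt A y) = gramA A *m y.
Proof.
apply/colP => i; rewrite opAE mxE dotC /opAt.
rewrite (big_morph (dot^~ (A i)) (fun U V => dotDl U V (A i)) (dot0l (A i))).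
by apply: eq_bigr => j _; rewrite dotZl mxE inner_dot // mulrC dotC.
Qed.

(** A kernel vector u of the Gram matrix has [opAt A u^T] = 0; pairing this with some X mapped to u
    by surjectivity gives |u|^2 = 0. *)
Lemma gramA_unit : gramA A \in unitmx.
Proof.
rewrite -row_free_unit; apply: inj_row_free => u uG.
have gramC : (gramA A)^T = gramA A.
  by apply/matrixP => i j; rewrite !mxE !inner_dot // dotC.
have Au0 : opAt A u^T = 0.
  apply: frob_eq0; apply/eqP; rewrite -sqrf_eq0 frob_sqr dot_opAt opA_opAt trmxK.
  by rewrite mulmxA uG mul0mx mxE.
have [X [_ AX]] := surjA u^T.
have := dot0l X; rewrite -Au0 dot_opAt trmxK AX mxE => /eqP.
rewrite psumr_eq0 => [|i _]; last by rewrite mxE -expr2 sqr_ge0.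
move=> /allP u0; apply/rowP => i; apply/eqP; rewrite [eqbRHS]mxE.
by have := u0 i (mem_index_enum _); rewrite mxE -expr2 sqrf_eq0.
Qed.

Lemma projPD X Y : projP A (X + Y) = projP A X + projP A Y.
Proof. by rewrite /projP opAD mulmxDr opAtD. Qed.

Lemma projPZ (a : R) X : projP A (a *: X) = a *: projP A X.
Proof. by rewrite /projP opAZ -scalemxAr opAtZ. Qed.

Lemma projPN X : projP A (- X) = - projP A X.
Proof. by rewrite -scaleN1r projPZ scaleN1r. Qed.

Lemma projPB X Y : projP A (X - Y) = projP A X - projP A Y.
Proof. by rewrite projPD projPN. Qed.

Lemma projP_opAt y : projP A (opAt A y) = opAt A y.
Proof. by rewrite /projP opA_opAt mulKmx // gramA_unit. Qed.

Lemma projP_id X : projP A (projP A X) = projP A X.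
Proof. exact: projP_opAt. Qed.

Lemma opA_projP X : opA A (projP A X) = opA A X.
Proof. by rewrite /projP opA_opAt mulKVmx // gramA_unit. Qed.

Lemma dot_projP X Y : dot (projP A X) (projP A Y) = dot (projP A X) Y.
Proof. by rewrite !dot_opAt opA_projP. Qed.

Lemma frob_projP_le X : frob (projP A X) <= frob X.
Proof.
have := dot_frob_le (projP A X) X; rewrite -dot_projP -frob_sqr expr2.
have [->|X0] := eqVneq (frob (projP A X)) 0; first by rewrite frob_ge0.
by rewrite ler_pM2l // lt0r X0 frob_ge0.
Qed.

Lemma symm_projP X : symm (projP A X).
Proof. exact: symm_opAt. Qed.

Variables (C : 'M[R]_n) (b : 'cV[R]_m) (sigma : R).
Notation step := (admm_step A C b sigma).

Lemma symm_admm_step Z : symm C -> symm Z -> symm (step Z).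
Proof.
move=> sC sZ; have [[sP _] _ _] := proj_psd_moreau Z.
rewrite /admm_step; apply: symmB (symmZ _ _ sC).
do 3?[apply: symmD];
  do ?[exact: symm_projP | exact: symm_opAt | exact: sP | exact/symmZ/symm_projP].
Qed.

(** The terms in b and C cancel. Replacing the increment of the projection by its linearization
    [opD] turns the right side into [opM]. *)
Lemma admm_stepB Z Z' :
  step Z - step Z' =
  projP A (Z - Z' - 2 *: (proj_psd Z - proj_psd Z')) + (proj_psd Z - proj_psd Z').
Proof.
rewrite /admm_step !(projPD, projPN, projPZ).
move: (projP A Z) (projP A Z') (projP A (proj_psd Z)) (projP A (proj_psd Z')) (projP A C).
move: (proj_psd Z) (proj_psd Z') (opAt A _) => P P' U a a' c c' d.
by apply/matrixP => i j; rewrite !mxE; ring.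
Qed.

(** Primal feasibility turns the b-term into [projP A X]; dual feasibility puts C - S in the range
    fixed by [projP]. *)
Lemma admm_step_kkt X y S : kkt A C b X y S ->
  proj_psd (X - sigma *: S) = X -> step (X - sigma *: S) = X - sigma *: S.
Proof.
move=> [AX [ySC _]] pX; rewrite /admm_step pX -AX -/(projP A X).
have -> : S = C - opAt A y by rewrite -ySC addrC addKr.
rewrite !(projPD, projPN, projPZ) projP_opAt.
move: (projP A X) (projP A C) (opAt A y) => p q u.
by apply/matrixP => i j; rewrite !mxE; ring.
Qed.

End RangeProjection.

(** * The linearized map and the local contraction *)

Section Linearization.
Context {R : realType} {n m : nat}.
Variable A : 'I_m -> 'M[R]_n.
Hypothesis symA : forall i, symm (A i).
Hypothesis surjA : forall b' : 'cV[R]_m, exists X, symm X /\ opA A X = b'.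
Variables (Q : 'M[R]_n) (lam : 'I_n -> R) (r : nat) (mu : R).
Hypothesis QV : Q^T *m Q = 1%:M.
Hypothesis mu_gt0 : 0 < mu.
Hypothesis lam_pos : forall i : 'I_n, (i < r)%N -> mu <= lam i.
Hypothesis lam_neg : forall i : 'I_n, (r <= i)%N -> lam i <= - mu.
Implicit Types (X Y H V W Z : 'M[R]_n).

Notation D := (opD Q lam r).
Notation M := (opM A Q lam r).
Notation fixM := (fixM A Q lam r).
Notation G := (fun H => M H - proj_onto fixM H).
Notation Zs := (Q *m diag_mx (\row_i lam i) *m Q^T).
Notation Xs := (Q *m diag_mx (\row_i lamp lam r i) *m Q^T).

Lemma opME H : M H = projP A H - 2 *: projP A (D H) + D H.
Proof.
rewrite /opM /opDperp /projPperp projPB //.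
move: (projP A H) (projP A _) (D H) => x y z.
by apply/matrixP => i j; rewrite !mxE; ring.
Qed.

Lemma opMB X Y : M (X - Y) = M X - M Y.
Proof.
rewrite !opME opDB !projPB //.
move: (projP A X) (projP A Y) (projP A (D X)) (projP A (D Y)) => a a' c c'.
move: (D X) (D Y) => d d'.
by apply/matrixP => i j; rewrite !mxE; ring.
Qed.

Lemma opMZ (a : R) X : M (a *: X) = a *: M X.
Proof.
rewrite !opME opDZ !projPZ //.
move: (projP A X) (projP A (D X)) (D X) => x y z.
by apply/matrixP => i j; rewrite !mxE; ring.
Qed.

Lemma opM0 : M 0 = 0.
Proof. by have := opMB 0 0; rewrite subr0 subrr. Qed.

(** The constant 1 + 2 + 1 comes from the three terms of [opME]; it serves to show that [fixM] is
    closed and that the supremum in [opnorm] is finite. *)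
Lemma frob_opM_le H : frob (M H) <= 4 * frob H.
Proof.
rewrite opME; have := frob_opD_le _ _ _ _ QV mu_gt0 lam_pos lam_neg H.
have := frob_projP_le _ symA surjA H; have := frob_projP_le _ symA surjA (D H).
have := frobD (projP A H - 2 *: projP A (D H)) (D H).
have := frobB (projP A H) (2 *: projP A (D H)).
by rewrite frobZ normr_nat; lra.
Qed.

Lemma fixM0 : fixM 0.
Proof. by split; [exact: symm0 | exact: opM0]. Qed.

Lemma fixMB X Y : fixM X -> fixM Y -> fixM (X - Y).
Proof. by move=> [sX MX] [sY MY]; split; [exact: symmB | rewrite opMB MX MY]. Qed.

Lemma fixMZ (a : R) X : fixM X -> fixM (a *: X).
Proof. by move=> [sX MX]; split; [exact: symmZ | rewrite opMZ MX]. Qed.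

Lemma fixMD X Y : fixM X -> fixM Y -> fixM (X + Y).
Proof.
by move=> fX fY; rewrite -(opprK Y) -(scaleN1r Y); apply: fixMB => //; exact: fixMZ.
Qed.

Lemma fixM_adherent X : adherent fixM X -> fixM X.
Proof.
move=> aX; split; first by apply: symm_adherent aX => Y [].
apply/eqP; rewrite -subr_eq0; apply/eqP/frob_eq0/eqP.
rewrite eq_le frob_ge0 andbT -oppr_ge0.
apply: (@ge0_adherent _ _ (fun Y => - frob (M Y - Y)) 5) aX => [Y Y'|Y [_ ->]]; last first.
  by rewrite subrr frob0 oppr0.
have [h1 h2] : frob (M Y - Y) - frob (M Y' - Y') <= 5 * frob (Y - Y') /\
    frob (M Y' - Y') - frob (M Y - Y) <= 5 * frob (Y - Y').
  have key U U' : frob (M U - U) - frob (M U' - U') <= 5 * frob (U - U').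
    have := frob_opM_le (U - U'); rewrite opMB; move: (M U) (M U') => a c h.
    have -> : a - U = (c - U') + ((a - c) - (U - U')).
      by apply/matrixP => i j; rewrite !mxE; ring.
    rewrite lerBlDr (le_trans (frobD _ _)) // addrC lerD2r.
    apply: le_trans (frobB _ _) _.
    have -> (x : R) : 5 * x = 4 * x + x by ring.
    by rewrite lerD2r.
  by split; [exact: key | rewrite (frob_distC Y); exact: key].
by rewrite ler_norml; apply/andP; split; lra.
Qed.

Lemma nearest_fixM H : nearest fixM H (proj_onto fixM H).
Proof.
apply/nearest_proj/nearest_exists; last exact: fixM_adherent.
- by exists 0; exact: fixM0.
- by move=> X Y fX fY; apply/fixMZ/fixMD.
Qed.

Lemma proj_fixM_orth H V : fixM V -> dot (H - proj_onto fixM H) V = 0.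
Proof.
move=> fV; have nH := nearest_fixM H; have [fp _] := nH.
have var U : fixM U -> 0 <= dot (proj_onto fixM H - H) U.
  by move=> fU; apply: (nearest_variation _ _ _ _ nH) => t _ _; apply/fixMD/fixMZ.
apply/eqP; rewrite -opprB dotNl oppr_eq0 eq_le var // andbT -oppr_ge0 -dotNr.
by apply: var; rewrite -scaleN1r; exact: fixMZ.
Qed.

(** Comparison with the competitor 0 and the triangle inequality give the factor 2, which reappears
    in the smallness conditions below. *)
Lemma frob_proj_fixM_le H : frob (proj_onto fixM H) <= 2 * frob H.
Proof.
have [_ /(_ 0 fixM0)] := nearest_fixM H; rewrite subr0.
by have := frobB H (H - proj_onto fixM H); rewrite subKr; lra.
Qed.

Lemma ubound_opnorm : ubound
  [set frob (G H) | H in [set H | symm H /\ frob H <= 1]] 6.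
Proof.
move=> _ [H [_ H1] <-] /=.
have := frobB (M H) (proj_onto fixM H).
have := frob_opM_le H; have := frob_proj_fixM_le H; lra.
Qed.

Lemma opnorm_ge0 : 0 <= opnorm G.
Proof.
apply: le_trans (frob_ge0 (G 0)) _; apply: ub_le_sup; first by exists 6; exact: ubound_opnorm.
by exists 0 => //; split; [exact: symm0 | rewrite frob0 ler01].
Qed.

(** After scaling W into the unit ball, its projection p onto [fixM] vanishes: |U - p| <= |U| and
    the orthogonality of U and p give |p|^2 <= 0. Hence M and M minus the projection agree at U. *)
Lemma frob_opM_orth_le W : symm W -> (forall V, fixM V -> dot W V = 0) ->
  frob (M W) <= opnorm G * frob W.
Proof.
move=> sW oW; have [W0|W0] := eqVneq (frob W) 0.
  by rewrite (frob_eq0 _ W0) opM0 frob0 mulr0.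
have Wgt0 : 0 < frob W by rewrite lt0r W0 frob_ge0.
set U := (frob W)^-1 *: W.
have U1 : frob U = 1 by rewrite frobZ ger0_norm ?invr_ge0 ?frob_ge0 // mulVf.
have p0 : proj_onto fixM U = 0.
  have [fp /(_ 0 fixM0)] := nearest_fixM U; rewrite subr0 frob_le.
  have Up : dot U (proj_onto fixM U) = 0 by rewrite dotZl oW ?mulr0.
  rewrite dotBl !dotBr (dotC _ U) Up !subr0 sub0r opprK -lerBrDl subrr -frob_sqr => p2.
  by apply: frob_eq0; apply/eqP; rewrite -sqrf_eq0 eq_le p2 sqr_ge0.
have : frob (M U) <= opnorm G.
  have -> : M U = G U by rewrite /= p0 subr0.
  apply: ub_le_sup; first by exists 6; exact: ubound_opnorm.
  by exists U => //; split; [exact: symmZ | rewrite U1].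
move: (opnorm _) => c; rewrite /U opMZ frobZ ger0_norm ?invr_ge0 ?frob_ge0 //.
by rewrite mulrC ler_pdivrMr.
Qed.

(* For a fixed V of M, D V and V - D V are orthogonal, so the nonnegative sum
   of Omega (1 - Omega) v^2 vanishes and kills the mixed blocks of V. *)
Lemma fixM_split V : fixM V ->
  [/\ projP A (D V) = 0, projP A V + D V = V &
    forall i j : 'I_n, (i < r)%N != (j < r)%N -> conj_mx Q V i j = 0].
Proof.
move=> [sV]; rewrite opME => MV.
(* Applying [projP] to M V = V gives P V - P D V = P V. Then V - D V = P V lies in the range of P
   and D V in its kernel, whence their orthogonality. *)
have PD0 : projP A (D V) = 0.
  have := congr1 (projP A) MV; rewrite !(projPD, projPN, projPZ) ?projP_id //.
  rewrite -addrA -{2}[projP A V]addr0 => /addrI.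
  by rewrite scaler_nat mulr2n opprD subrK => /eqP; rewrite oppr_eq0 => /eqP.
move: MV; rewrite PD0 scaler0 subr0 => MV; split=> // i j ij.
have : dot (V - D V) (D V) = 0.
  by rewrite -[X in X - _]MV addrK -dot_projP // PD0 dot0r.
rewrite -(dot_conj Q) // conjB conj_mx_opD //; set v := conj_mx Q V; clearbody v.
rewrite dotE => /eqP.
have Om k l : (v - hadamard (Omega lam r) v) k l * hadamard (Omega lam r) v k l =
    Omega lam r k l * (1 - Omega lam r k l) * v k l ^+ 2.
  move: (Omega lam r) => O; rewrite !mxE; ring.
have Om0 k l : 0 <= Omega lam r k l * (1 - Omega lam r k l) * v k l ^+ 2.
  apply: mulr_ge0; last exact: sqr_ge0.
  by rewrite mulr_ge0 ?subr_ge0 ?(Omega_ge0 _ _ mu) ?(Omega_le1 _ _ mu).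
rewrite (eq_bigr _ (fun k _ => eq_bigr _ (fun l _ => Om k l))).
rewrite psumr_eq0 => [/allP /(_ i (mem_index_enum _))|k _]; last exact: sumr_ge0.
rewrite psumr_eq0 => [/allP /(_ j (mem_index_enum _))|l _] //=.
rewrite mulf_eq0 sqrf_eq0 => /orP[|/eqP //].
by rewrite gt_eqF // (Omega_mixed _ _ mu).
Qed.

Variables (C : 'M[R]_n) (b : 'cV[R]_m) (sigma : R).
Notation step := (admm_step A C b sigma).
Hypothesis step_center : step Zs = Zs.

Lemma proj_psd_center : proj_psd Zs = Xs.
Proof. exact/moreau_unique/(moreau_center _ _ _ mu). Qed.

Lemma step_fixM V : fixM V -> n%:R * frob V <= mu -> step (Zs + V) = Zs + V.
Proof.
move=> fV nV; have [PD PV V0] := fixM_split _ fV; have [sV _] := fV.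
have pV : proj_psd (Zs + V) = Xs + D V by apply/moreau_unique/(moreau_block _ _ _ mu).
have := admm_stepB A symA C b sigma (Zs + V) Zs.
have ZV : Zs + V - Zs = V by rewrite addrC addKr.
have XD : Xs + D V - Xs = D V by rewrite addrC addKr.
rewrite pV proj_psd_center step_center ZV XD projPB // projPZ // PD scaler0 subr0 PV.
by move/eqP; rewrite subr_eq addrC => /eqP.
Qed.

(** The error e of the psd projection enters as e - 2 P e, hence the factor 3. *)
Lemma step_strict_diff Z Z' : symm Z -> symm Z' ->
  frob (step Z - step Z' - M (Z - Z')) <=
  3 * n%:R ^+ 3 / mu * (frob (Z - Zs) + frob (Z' - Zs)) * frob (Z - Z').
Proof.
move=> sZ sZ'.
have := proj_psd_strict_diff _ _ _ _ QV mu_gt0 lam_pos lam_neg Z Z' sZ sZ'.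
set e := proj_psd Z - _ - _; set c := _ * frob (Z - Z') => ec.
have -> : step Z - step Z' - M (Z - Z') = e - 2 *: projP A e.
  rewrite admm_stepB // opME /e; move: (Z - Z') (proj_psd Z - proj_psd Z') => W P.
  rewrite !(projPB _ symA) projPZ //.
  move: (projP A W) (projP A P) (projP A (D W)) (D W) => x y z t.
  by apply/matrixP => i j; rewrite !mxE; ring.
have -> : 3 * n%:R ^+ 3 / mu * (frob (Z - Zs) + frob (Z' - Zs)) * frob (Z - Z') = 3 * c.
  by rewrite /c; ring.
rewrite (le_trans (frobB _ _)) // frobZ normr_nat.
have := frob_projP_le _ symA surjA e; move: (frob (projP A e)) ec => x; clearbody c.
move: (frob e) => y; lra.
Qed.

Notation gap H := (frob (H - proj_onto fixM H)).

(** The old projection V is kept as competitor for the new gap, and [Zs + V] does not move under the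
    step. The 3 before [frob (Z - Zs)] bounds |H| + |V|, as |V| <= 2 |H|. *)
Lemma gap_step_le (rho : R) Z : symm Z -> n%:R * (2 * frob (Z - Zs)) <= mu ->
  3 * n%:R ^+ 3 / mu * (3 * frob (Z - Zs)) <= rho - opnorm G ->
  gap (step Z - Zs) <= rho * gap (Z - Zs).
Proof.
move=> sZ small1 small2; set H := Z - Zs; set V := proj_onto fixM H.
have fV : fixM V by have [] := nearest_fixM H.
have VH : frob V <= 2 * frob H by exact: frob_proj_fixM_le.
have [_ /(_ V fV) near] := nearest_fixM (step Z - Zs); apply: le_trans near _.
have sV : symm V by have [] := fV.
have sZs : symm Zs by exact: symm_center.
have nV : n%:R * frob V <= mu by apply: le_trans small1; rewrite ler_wpM2l.
have -> : step Z - Zs - V = step Z - step (Zs + V).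
  by rewrite (step_fixM _ fV nV) opprD addrA.
have WE : Z - (Zs + V) = H - V by rewrite opprD addrA.
have := step_strict_diff _ _ sZ (symmD _ _ sZs sV).
rewrite WE [Zs + V - Zs]addrC addKr; set c := 3 * _ / mu; set W := H - V => err.
have c0 : 0 <= c by rewrite /c !mulr_ge0 ?exprn_ge0 // invr_ge0 ltW.
have MW : frob (M W) <= opnorm G * frob W.
  apply: frob_opM_orth_le => [|U fU]; last exact: proj_fixM_orth.
  by apply: symmB => //; exact: symmB.
have dW : c * (frob H + frob V) * frob W <= (rho - opnorm G) * frob W.
  rewrite ler_wpM2r ?frob_ge0 //; apply: le_trans small2.
  by rewrite ler_wpM2l //; have := VH; move: (frob V) (frob H) => x y; lra.
rewrite -[step Z - _](subrK (M W)) (le_trans (frobD _ _)) //.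
move: (le_trans err dW) MW; move: (frob (_ - M W)) (frob (M W)) (opnorm _) (frob W).
by move=> x y k w; lra.
Qed.

Lemma dist_le_gap Z : symm Z -> n%:R * (2 * frob (Z - Zs)) <= mu ->
  dist Z [set Z | symm Z /\ step Z = Z] <= gap (Z - Zs).
Proof.
move=> sZ small; set V := proj_onto fixM (Z - Zs).
have fV : fixM V by have [] := nearest_fixM (Z - Zs).
have nV : n%:R * frob V <= mu.
  by apply: le_trans small; rewrite ler_wpM2l // frob_proj_fixM_le.
apply: ge_inf; first by exists 0 => _ [W _ <-]; exact: frob_ge0.
exists (Zs + V); last by rewrite opprD addrA.
split; last exact: step_fixM.
by apply: symmD; [exact: symm_center | have [] := fV].
Qed.

End Linearization.

(** * From the local contraction to the R-linear rate *)

(** Starting the minimum at 1 covers the empty index type. *)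
Lemma pos_lower_bound {R : realType} {n : nat} (f : 'I_n -> R) :
  (forall i, 0 < f i) -> exists2 mu : R, 0 < mu & forall i, mu <= f i.
Proof.
move=> f0; exists (\big[Num.min/1]_i f i); last by move=> i; exact: bigmin_le.
by elim/big_ind: _ => // x y x0 y0; rewrite lt_min x0.
Qed.

Theorem theorem4 (R : realType) (n m : nat) (C : 'M[R]_n) (A : 'I_m -> 'M[R]_n)
  (b : 'cV[R]_m) (sigma : R) (Z0 : 'M[R]_n)
  (Xs : 'M[R]_n) (ys : 'cV[R]_m) (Ss : 'M[R]_n)
  (Q : 'M[R]_n) (lam : 'I_n -> R) (r : nat) :
  symm C -> (forall i, symm (A i)) ->
  (* A surjective (from S^n onto R^m) *)
  (forall b' : 'cV[R]_m, exists X, symm X /\ opA A X = b') ->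
  0 < sigma -> symm Z0 ->
  kkt A C b Xs ys Ss ->
  (\rank Xs + \rank Ss)%N = n ->
  (* Z^(k) -> Z_star = X_star - sigma S_star *)
  (forall eps : R, 0 < eps -> exists K : nat, forall k : nat, (K <= k)%N ->
      frob (iter k (admm_step A C b sigma) Z0 - (Xs - sigma *: Ss)) < eps) ->
  (* eigendecomposition of Z_star *)
  Q^T *m Q = 1%:M ->
  Xs - sigma *: Ss = Q *m diag_mx (\row_i lam i) *m Q^T ->
  (forall i j : 'I_n, (i <= j)%N -> lam j <= lam i) ->
  (forall i : 'I_n, (i < r)%N -> 0 < lam i) ->
  (forall i : 'I_n, (r <= i)%N -> lam i < 0) ->
  r = \rank Xs ->
  Xs = Q *m diag_mx (\row_i (if (i < r)%N then lam i else 0)) *m Q^T ->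
  forall rho0 : R,
    opnorm (fun H => opM A Q lam r H - proj_onto (fixM A Q lam r) H) < rho0 ->
    rho0 < 1 ->
    exists kbar : nat, exists alpha : R, exists rho : R,
      0 < alpha /\ 0 < rho /\ rho < 1 /\
      forall k : nat, (kbar <= k)%N ->
        dist (iter k (admm_step A C b sigma) Z0)
             [set Z | symm Z /\ admm_step A C b sigma Z = Z]
        <= alpha * rho ^+ k.
Proof.
move=> symC symA surjA sigma0 symZ0 kktS _ cvgZ QV ZsE _ lam_gt0 lam_lt0 _ XsE rho0.
have [mu mu0 lam_mu] : exists2 mu : R, 0 < mu & forall i, mu <= `|lam i|.
  apply: pos_lower_bound => i; rewrite normr_gt0.
  by case: (ltnP i r) => [/lam_gt0|/lam_lt0] h; [rewrite gt_eqF | rewrite lt_eqF].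
have lam_pos (i : 'I_n) : (i < r)%N -> mu <= lam i.
  by move=> /lam_gt0 h; rewrite -[lam i]gtr0_norm.
have lam_neg (i : 'I_n) : (r <= i)%N -> lam i <= - mu.
  by move=> /lam_lt0 h; rewrite lerNr -[- lam i]ltr0_norm.
set G := fun H => _ => Grho rho1.
have kappa0 := opnorm_ge0 A symA surjA Q lam r mu QV mu0 lam_pos lam_neg.
have rho_gt0 : 0 < rho0 by exact: le_lt_trans Grho.
set F := admm_step A C b sigma in cvgZ *.
have Zs_fixed : F (Q *m diag_mx (\row_i lam i) *m Q^T) = Q *m diag_mx (\row_i lam i) *m Q^T.
  rewrite -ZsE; apply: (admm_step_kkt A symA surjA _ _ _ _ _ _ kktS).
  rewrite ZsE XsE; exact: (proj_psd_center Q lam r mu QV mu0 lam_pos lam_neg).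
rewrite ZsE in cvgZ; set Zs := Q *m diag_mx _ *m Q^T in cvgZ Zs_fixed.
have symZ k : symm (iter k F Z0).
  by elim: k => //= k IHk; exact: symm_admm_step.
pose c : R := 3 * n%:R ^+ 3 / mu.
have c0 : 0 <= c by rewrite /c !mulr_ge0 ?exprn_ge0 // invr_ge0 ltW.
(* The first bound keeps [Zs + V] among the exact fixed points, the second fits the expansion error
   into [rho0 - opnorm G]. Adding 1 keeps the denominators positive when n = 0. *)
pose delta : R := Num.min (mu / (2 * n%:R + 1)) ((rho0 - opnorm G) / (3 * c + 1)).
have n1 : 0 < 2 * n%:R + 1 :> R by rewrite ltr_wpDl ?mulr_ge0.
have c1 : 0 < 3 * c + 1 by apply: ltr_wpDl => //; apply: mulr_ge0.
have delta0 : 0 < delta by rewrite lt_min !divr_gt0 ?subr_gt0.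
have [K HK] := cvgZ _ delta0.
have small1 k : (K <= k)%N -> n%:R * (2 * frob (iter k F Z0 - Zs)) <= mu.
  move=> /HK /ltW; rewrite le_min => /andP[+ _].
  rewrite ler_pdivlMr // => h; have := frob_ge0 (iter k F Z0 - Zs).
  move: h; set x := frob _; lra.
have small2 k : (K <= k)%N -> c * (3 * frob (iter k F Z0 - Zs)) <= rho0 - opnorm G.
  move=> /HK /ltW; rewrite le_min => /andP[_].
  rewrite ler_pdivlMr // => h; have := frob_ge0 (iter k F Z0 - Zs).
  move: h; set x := frob _; lra.
pose d k := frob (iter k F Z0 - Zs - proj_onto (fixM A Q lam r) (iter k F Z0 - Zs)).
have dS k : (K <= k)%N -> d k.+1 <= rho0 * d k.
  move=> Kk; exact: (gap_step_le A symA surjA Q lam r mu QV mu0 lam_pos lam_neg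
    C b sigma Zs_fixed _ _ (symZ k) (small1 _ Kk) (small2 _ Kk)).
have dK j : d (K + j)%N <= rho0 ^+ j * d K.
  elim: j => [|j IHj]; first by rewrite addn0 expr0 mul1r.
  rewrite addnS exprS -mulrA (le_trans (dS _ (leq_addr _ _))) //.
  by rewrite ler_wpM2l // ltW.
(* Dividing by [rho0 ^+ K] shifts the exponent from k - K to k; the added 1 keeps alpha positive
   when [d K] = 0. *)
exists K, ((d K + 1) / rho0 ^+ K), rho0; split; last split => //; last split => //.
  by rewrite divr_gt0 ?exprn_gt0 // ltr_wpDl // frob_ge0.
move=> k Kk; apply: (le_trans (dist_le_gap A symA surjA Q lam r mu QV mu0 lam_pos lam_neg
  C b sigma Zs_fixed _ (symZ k) (small1 _ Kk))).
rewrite -/(d k) -(subnKC Kk) exprD mulrA divfK ?expf_neq0 ?gt_eqF //.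
apply: le_trans (dK _) _; rewrite mulrC ler_wpM2r ?exprn_ge0 ?lerDl //; exact: ltW.
Qed.
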